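(* For every integer $m\ge 1$, $$\sum_{n=1}^{\infty}\frac{\zeta(2n)}{n4^n}\binom{2n}{m}=\begin{cases}\dfrac{1}{m} & \text{if } m \text{ is odd},\\[2mm] \dfrac{1}{m}\left(2\zeta(m)\left(1-\dfrac{1}{2^m}\right)-1\right) & \text{if } m \text{ is even}.\end{cases}$$
   Context: $\zeta(s)=\sum_{n=1}^\infty n^{-s}$ (for $\operatorname{Re}(s)>1$) is the Riemann zeta function. Binomial coefficients satisfy $\binom{2n}{m}=0$ when $m>2n$. *)

(* Defs.v *)
From HB Require Import structures.
From mathcomp Require Import all_boot all_order all_algebra.
From mathcomp Require Import all_classical all_reals all_analysis.
From mathcomp Require Import complex.

Set Implicit Arguments.
Unset Strict Implicit.
Unset Printing Implicit Defensive.

Import Order.TTheory GRing.Theory Num.Theory.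
Import numFieldNormedType.Exports.

Local Open Scope classical_set_scope.
Local Open Scope ring_scope.
Local Open Scope complex_scope.

Definition expC (R : realType) (z : R[i]) : R[i] :=
  (expR (complex.Re z))%:C * (cos (complex.Im z) +i* sin (complex.Im z)).

(* n ^ s for n > 0, with the real logarithm of n *)
Definition natpowC (R : realType) (n : nat) (s : R[i]) : R[i] :=
  expC (s * (ln (n%:R : R))%:C).

(* The limit is taken for the modulus topology of [R[i]^o], the complex numbers
   as a normed space over themselves.  The series converges, and the value is
   meaningful, only for 1 < Re s; elsewhere [lim] returns a default point. *)
Definition zeta (R : realType) (s : R[i]) : R[i] :=
  lim ((\sum_(1 <= n < N.+1) natpowC n (- s) : R[i]^o) @[N --> \oo]).

(* Main.v *)
Require Import Defs.
From mathcomp Require Import all_boot all_order all_algebra.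
From mathcomp Require Import all_classical all_reals all_analysis.
From mathcomp Require Import complex.
From mathcomp Require Import ring lra.
Import Order.TTheory GRing.Theory Num.Theory.
Import numFieldNormedType.Exports.
Local Open Scope classical_set_scope.
Local Open Scope ring_scope.
Local Open Scope complex_scope.

(** Since [zeta (2 n) = sum_(k >= 1) k ^- (2 n)], the left-hand side is the
    double series of the nonnegative terms
      [a n k = 'C(2 n, m) / n * (2 k) ^- (2 n)],
    so it may be summed over [n] first ([cvg_series_exchange]).  For fixed [k],
    put [x = 1 / (2 k)].  The absorption identity
      ['C(2 n, m) / n = 2 / m * 'C(2 n - 1, m - 1)]
    turns the series over [n] into the odd part of the binomial series
      [sum_j 'C(j, m - 1) x ^ j = x ^ (m - 1) / (1 - x) ^ m]
    ([cvg_binomial_series]), whence it equals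
      [1 / m * ((x / (1 - x)) ^ m + (- x / (1 + x)) ^ m)
       = 1 / m * ((2 k - 1) ^- m + (-1) ^ m * (2 k + 1) ^- m)]
    ([cvg_even_binomial_series]).  It remains to sum over [k]
    ([cvg_alternating_reciprocals]).  For odd [m] the sum telescopes to [1 / m];
    for even [m] the reciprocal powers of the odd numbers are counted twice,
    except for the first one, and they add up to [zeta m * (1 - 2 ^- m)].

    All these series are real.  The computation therefore takes place in [R],
    with [rzeta] for the values of zeta at integers above 1, and is carried to [R[i]]
    at the end ([zeta_natE], [cvg_real_complex]). *)

(** * Zeta at integers as a real number *)

Lemma cvg_real_complex (R : realType) (u : nat -> R) (l : R) :
  u @ \oo --> l -> ((u n)%:C : R[i]^o) @[n --> \oo] --> (l%:C : R[i]^o).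
Proof.
move=> /cvgrPdist_lt ul; apply/cvgrPdist_lt => -[e i].
rewrite ltcE /= => /andP[/eqP -> e0].
near=> n.
rewrite -rmorphB normc_def /= expr0n addr0 sqrtr_sqr ltcR.
by near: n; apply: ul.
Unshelve. all: by end_near. Qed.

Lemma natpowC_nat (R : realType) (n k : nat) :
  natpowC n.+1 (- k%:R) = ((n.+1%:R : R) ^- k)%:C.
Proof.
rewrite /natpowC -(rmorph_nat (real_complex R)) -rmorphN -rmorphM.
rewrite /expC /= cos0 sin0.
have -> : 1 +i* 0 = 1 :> R[i] by [].
by rewrite mulr1 mulNr expRN expRM_natl lnK // posrE ltr0n.
Qed.

Definition rzeta (R : realType) (k : nat) : R :=
  limn (fun N => \sum_(0 <= n < N) (n.+1%:R : R) ^- k).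

(** The partial sums increase and, by comparison with the exponent 2 and the
    telescoping terms [1 / (n (n + 1))], are bounded by 2. *)
Lemma cvg_rzeta (R : realType) (k : nat) : (2 <= k)%N ->
  (\sum_(0 <= n < N) (n.+1%:R : R) ^- k) @[N --> \oo] --> rzeta R k.
Proof.
move=> k2; apply: nondecreasing_is_cvgn.
  apply/nondecreasing_seqP => N; rewrite big_nat_recr //= lerDl invr_ge0.
  by rewrite exprn_ge0.
have bound N : \sum_(0 <= n < N.+1) (n.+1%:R : R) ^- k <= 2 - N.+1%:R^-1.
  elim: N => [|N IH].
    by rewrite big_nat1 !mulr1n expr1n invr1; lra.
  rewrite big_nat_recr //=.
  have le2 : (N.+2%:R : R) ^- k <= N.+2%:R ^- 2.
    by rewrite lef_pV2 ?posrE ?exprn_gt0 ?ltr0n // ler_weXn2l ?ler1n.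
  have le3 : (N.+2%:R : R) ^- 2 <= N.+1%:R^-1 - N.+2%:R^-1.
    have p1 : 0 < N.+1%:R :> R by rewrite ltr0n.
    have e2 : N.+2%:R = N.+1%:R + 1 :> R by rewrite -[in LHS]addn1 natrD.
    rewrite e2; have -> : N.+1%:R^-1 - (N.+1%:R + 1)^-1 =
        (N.+1%:R * (N.+1%:R + 1))^-1 :> R.
      by field; apply/andP; split; apply: lt0r_neq0; lra.
    by rewrite lef_pV2 ?posrE; nra.
  by rewrite (le_trans (lerD IH (le_trans le2 le3))) // addrA subrK.
exists 2 => _ [[|N] _ <-]; first by rewrite big_nil.
by apply: le_trans (bound N) _; rewrite gerBl invr_ge0.
Qed.

Lemma zeta_natE (R : realType) (k : nat) : (2 <= k)%N ->
  zeta k%:R = (rzeta R k)%:C :> R[i].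
Proof.
move=> k2; apply: (@cvg_lim (R[i]^o)); first exact: norm_hausdorff.
have -> : (fun N => \sum_(1 <= n < N.+1) natpowC n (- k%:R) : R[i]^o) =
  (fun N => (\sum_(0 <= n < N) (n.+1%:R : R) ^- k)%:C).
  apply/funext => N; rewrite big_add1 /= rmorph_sum.
  by apply: eq_bigr => n _; rewrite natpowC_nat.
exact/cvg_real_complex/cvg_rzeta.
Qed.

(** * Exchanging the order of summation *)

Lemma cvg_nneseriesP (R : realType) (u : nat -> R) (l : R) :
  (forall k, 0 <= u k) ->
  \sum_(0 <= k < N) u k @[N --> \oo] --> l <->
  (\sum_(0 <= k <oo) (u k)%:E = l%:E)%E.
Proof.
move=> u0; have E : (fun N => \sum_(0 <= k < N) (u k)%:E)%E =
    EFin \o (fun N => \sum_(0 <= k < N) u k).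
  by apply/funext => N; rewrite sumEFin.
split=> [ul|ul].
  apply: cvg_lim => //; rewrite E; apply: cvg_EFin => //.
  by near=> N.
have : cvgn (fun N => \sum_(0 <= k < N) (u k)%:E)%E.
  by apply: is_cvg_nneseries => k _ _; rewrite lee_fin.
move=> /cvg_ex[/= x ux].
by have := ux; rewrite -(cvg_lim _ ux) // ul E => /fine_cvgP[].
Unshelve. all: by end_near. Qed.

(** Tonelli for series of real numbers: the exchange is always possible for
    nonnegative extended real sums, and here these are finite. *)
Lemma cvg_series_exchange (R : realType) (a : nat -> nat -> R)
    (A B : nat -> R) (L : R) :
  (forall i j, 0 <= a i j) ->
  (forall i, \sum_(0 <= j < N) a i j @[N --> \oo] --> A i) ->
  (forall j, \sum_(0 <= i < N) a i j @[N --> \oo] --> B j) ->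
  \sum_(0 <= j < N) B j @[N --> \oo] --> L ->
  \sum_(0 <= i < N) A i @[N --> \oo] --> L.
Proof.
move=> a0 aA aB BL.
have AE i := (cvg_nneseriesP _ _ _ (a0 i)).1 (aA i).
have BE j := (cvg_nneseriesP _ _ _ (a0 ^~ j)).1 (aB j).
have A0 i : 0 <= A i.
  by rewrite -lee_fin -AE; apply: nneseries_ge0 => *; rewrite lee_fin.
have B0 j : 0 <= B j.
  by rewrite -lee_fin -BE; apply: nneseries_ge0 => *; rewrite lee_fin.
apply/(cvg_nneseriesP _ _ _ A0).
rewrite -((cvg_nneseriesP _ _ _ B0).1 BL).
under eq_eseriesr do rewrite -AE.
rewrite nneseries_interchange => [|i j]; last by rewrite lee_fin.
by apply: eq_eseriesr => j _; rewrite BE.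
Qed.

(** * The binomial series and its odd part *)

(** Pascal's rule, with the boundary term left by truncating the identity
    [(1 - x) * sum_j 'C(j, r + 1) x ^ j = x * sum_j 'C(j, r) x ^ j]. *)
Lemma binomial_sumS (R : comNzRingType) (x : R) (r N : nat) :
  (1 - x) * \sum_(0 <= j < N) 'C(j, r.+1)%:R * x ^+ j =
  x * (\sum_(0 <= j < N) 'C(j, r)%:R * x ^+ j) - 'C(N, r.+1)%:R * x ^+ N.
Proof.
elim: N => [|N IH]; first by rewrite !big_nil bin0n !(mulr0, mul0r, subr0).
rewrite !big_nat_recr //= !mulrDr IH binS natrD exprS; ring.
Qed.

(** The terms for [`|x|] are those of a convergent series: by induction on [r]
    with [binomial_sumS], where the boundary term has the favourable sign, its
    partial sums are bounded by [(1 - `|x|) ^- r.+1]. *)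
Lemma binomial_term_cvg0 (R : realType) (x : R) (r : nat) : `|x| < 1 ->
  'C(N, r)%:R * x ^+ N @[N --> \oo] --> 0.
Proof.
move=> x1; set y := `|x|.
have y0 : 0 <= y by rewrite normr_ge0.
have y1 : 0 < 1 - y by rewrite subr_gt0.
have bound s N : \sum_(0 <= j < N) 'C(j, s)%:R * y ^+ j <= (1 - y) ^- s.+1.
  elim: s => [|s IH].
    rewrite -(ler_pM2l y1).
    have -> : (1 - y) * (\sum_(0 <= j < N) 'C(j, 0)%:R * y ^+ j) = 1 - y ^+ N.
      rewrite -opprB -[in RHS]opprB subrX1 mulNr big_mkord; congr (- (_ * _)).
      by apply: eq_bigr => j _; rewrite bin0 mul1r.
    by rewrite expr1 divff ?gt_eqF // gerBl exprn_ge0.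
  rewrite -(ler_pM2l y1) binomial_sumS.
  rewrite [_ ^+ s.+2]exprS invfM mulVKf ?gt_eqF //.
  apply: le_trans IH.
  apply: (@le_trans _ _ (y * \sum_(0 <= j < N) 'C(j, s)%:R * y ^+ j)).
    by rewrite gerBl mulr_ge0 ?exprn_ge0.
  rewrite ler_piMl //; last by rewrite ltW.
  by apply: sumr_ge0 => j _; rewrite mulr_ge0 ?exprn_ge0.
apply/norm_cvg0P.
have -> : (fun N => `|'C(N, r)%:R * x ^+ N|) = (fun N => 'C(N, r)%:R * y ^+ N).
  by apply/funext => N; rewrite normrM normrX normr_nat.
apply: cvg_series_cvg_0; apply: nondecreasing_is_cvgn.
  apply/nondecreasing_seqP => N; rewrite /series /= big_nat_recr //= lerDl.
  by rewrite mulr_ge0 ?exprn_ge0.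
by exists ((1 - y) ^- r.+1) => _ [N _ <-]; apply: bound.
Qed.

Lemma cvg_binomial_series (R : realType) (x : R) (r : nat) : `|x| < 1 ->
  \sum_(0 <= j < N) 'C(j, r)%:R * x ^+ j @[N --> \oo] -->
  x ^+ r / (1 - x) ^+ r.+1.
Proof.
move=> x1; have x0 : 1 - x != 0.
  by rewrite subr_eq0; apply: contraTneq x1 => <-; rewrite normr1 ltxx.
elim: r => [|r IH].
  have -> : (fun N => \sum_(0 <= j < N) 'C(j, 0)%:R * x ^+ j) =
      series (geometric 1 x).
    by apply/funext => N; apply: eq_bigr => j _; rewrite bin0.
  by rewrite expr0 expr1; apply: cvg_geometric_series.
have -> : (fun N => \sum_(0 <= j < N) 'C(j, r.+1)%:R * x ^+ j) =
  (fun N => (1 - x)^-1 * (x * (\sum_(0 <= j < N) 'C(j, r)%:R * x ^+ j)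
     - 'C(N, r.+1)%:R * x ^+ N)).
  by apply/funext => N; rewrite -binomial_sumS mulKf.
have -> : x ^+ r.+1 / (1 - x) ^+ r.+2 =
   (1 - x)^-1 * (x * (x ^+ r / (1 - x) ^+ r.+1) - 0).
  by rewrite subr0 exprS [_ ^+ r.+2]exprS; field; rewrite expf_neq0.
apply: cvgMl_tmp; apply: cvgB; last exact: binomial_term_cvg0.
exact: cvgMl_tmp.
Qed.

(** Absorption, [n.+1.*2 * 'C(n.*2.+1, m) = m.+1 * 'C(n.+1.*2, m.+1)], makes the
    left-hand side [x / m.+1] times twice the sum of the odd-degree terms
    ['C(j, m) x ^ j], which subtracting the series in [- x] isolates. *)
Lemma even_binomial_sumE (R : realType) (x : R) (m N : nat) :
  \sum_(0 <= n < N) 'C(n.+1.*2, m.+1)%:R / n.+1%:R * x ^+ n.+1.*2 =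
  x / m.+1%:R * (\sum_(0 <= j < N.*2) 'C(j, m)%:R * x ^+ j -
                 \sum_(0 <= j < N.*2) 'C(j, m)%:R * (- x) ^+ j).
Proof.
elim: N => [|N IH]; first by rewrite !big_nil subr0 mulr0.
rewrite big_nat_recr //= IH doubleS !(@big_nat_recr _ _ _ N.*2.+1) //=.
rewrite !(@big_nat_recr _ _ _ N.*2) //=.
have bin : (N.+1%:R * 2) * 'C(N.*2.+1, m)%:R =
    m.+1%:R * 'C(N.*2.+2, m.+1)%:R :> R.
  by rewrite -!natrM -mul_bin_diag muln2 doubleS.
have p1 : N.+1%:R != 0 :> R by rewrite pnatr_eq0.
have p2 : m.+1%:R != 0 :> R by rewrite pnatr_eq0.
have -> : 'C(N.*2.+2, m.+1)%:R =
    (N.+1%:R * 2) * 'C(N.*2.+1, m)%:R / m.+1%:R :> R.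
  by rewrite bin mulrC mulKf.
have e1 : (- x) ^+ N.*2 = x ^+ N.*2 by rewrite -muln2 mulnC !exprM sqrrN.
by rewrite !exprS e1; field; apply/andP.
Qed.

Lemma cvg_double : N.*2 @[N --> \oo] --> \oo.
Proof.
by under [X in X @ _]funext do rewrite -muln2; exact: cvg_mulnr.
Qed.

(** At [x = 1 / (2 k + 2)] one has [x / (1 - x) = 1 / (2 k + 1)] and
    [x / (1 + x) = 1 / (2 k + 3)]. *)
Lemma cvg_even_binomial_series (R : realType) (m k : nat) :
  \sum_(0 <= n < N)
     'C(n.+1.*2, m.+1)%:R / n.+1%:R * (k.+1.*2%:R : R)^-1 ^+ n.+1.*2
    @[N --> \oo] -->
  (m.+1%:R^-1 *
     (k.*2.+1%:R ^- m.+1 + (-1) ^+ m.+1 * k.+1.*2.+1%:R ^- m.+1) : R).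
Proof.
set x : R := k.+1.*2%:R^-1.
have x0 : 0 < x by rewrite invr_gt0 ltr0n.
have xh : x <= 2^-1 by rewrite lef_pV2 ?posrE ?ltr0n // ler_nat.
have x1 : `|x| < 1.
  by rewrite gtr0_norm // (le_lt_trans xh) // invf_lt1 ?ltr1n.
have Nx1 : `|- x| < 1 by rewrite normrN.
under [X in X @ _ --> _]funext do rewrite even_binomial_sumE.
have lim (y : R) : `|y| < 1 ->
    \sum_(0 <= j < N.*2) 'C(j, m)%:R * y ^+ j @[N --> \oo]
     --> (y ^+ m / (1 - y) ^+ m.+1 : R).
  move=> y1.
  exact: (cvg_comp double _ cvg_double (cvg_binomial_series R y m y1)).
have -> : m.+1%:R^-1 *
      (k.*2.+1%:R ^- m.+1 + (-1) ^+ m.+1 * k.+1.*2.+1%:R ^- m.+1) =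
    x / m.+1%:R * (x ^+ m / (1 - x) ^+ m.+1 - (- x) ^+ m / (1 - - x) ^+ m.+1).
  have -> : k.*2.+1%:R = (1 - x) / x.
    rewrite mulrBl divff ?gt_eqF // mul1r invrK doubleS.
    by rewrite -(natr1 k.*2.+1) addrK.
  have -> : k.+1.*2.+1%:R = (1 + x) / x.
    by rewrite mulrDl divff ?gt_eqF // mul1r invrK -natr1.
  have x0' : x != 0 by rewrite gt_eqF.
  have xm0 : 1 - x != 0.
    by rewrite gt_eqF ?subr_gt0 // (le_lt_trans (ler_norm x)).
  have xp0 : 1 + x != 0 by rewrite gt_eqF ?addr_gt0.
  have m0 : m.+1%:R != 0 :> R by rewrite pnatr_eq0.
  rewrite opprK [in (- x) ^+ m]exprNn !expr_div_n !exprS.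
  by field; rewrite nat1r m0 !expf_neq0 ?x0' ?xm0 ?xp0.
apply: cvgMl_tmp; apply: cvgB; exact: lim.
Qed.

(** * Summing reciprocal powers of odd numbers *)

(** Up to [2 K], the odd numbers are what remains after removing the doubles of
    the numbers up to [K], whose reciprocal powers carry the factor [2 ^- m]. *)
Lemma cvg_odd_reciprocals (R : realType) (m : nat) : (2 <= m)%N ->
  \sum_(0 <= k < K) (k.*2.+1%:R : R) ^- m @[K --> \oo] -->
  (rzeta R m * (1 - 2 ^- m) : R).
Proof.
move=> m2.
have E : (fun K => \sum_(0 <= k < K) (k.*2.+1%:R : R) ^- m) =
  (fun K => \sum_(0 <= n < K.*2) (n.+1%:R : R) ^- m -
     2 ^- m * \sum_(0 <= n < K) (n.+1%:R : R) ^- m).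
  apply/funext; elim=> [|K IH]; first by rewrite !big_nil mulr0 subr0.
  rewrite doubleS !(@big_nat_recr _ _ _ K) //= IH.
  rewrite !(@big_nat_recr _ _ _ K.*2.+1) //=.
  rewrite !(@big_nat_recr _ _ _ K.*2) //= mulrDr -invfM -exprMn -natrM.
  by rewrite mul2n doubleS; ring.
rewrite E mulrBr mulr1 [_ * 2 ^- m]mulrC.
apply: cvgB; last by apply: cvgMl_tmp; exact: cvg_rzeta.
exact: (cvg_comp double _ cvg_double (cvg_rzeta R m m2)).
Qed.

Lemma cvg_odd_reciprocal (R : realType) (m : nat) : (1 <= m)%N ->
  (K.*2.+1%:R : R) ^- m @[K --> \oo] --> (0 : R).
Proof.
move=> m1.
apply: (@squeeze_cvgr _ \oo _ R (fun=> 0) (@harmonic R) _ _ 0);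
  last exact: cvg_harmonic.
  near=> K; rewrite invr_ge0 exprn_ge0 //= lef_pV2 ?posrE ?exprn_gt0 ?ltr0n //.
  apply: (@le_trans _ _ (K.*2.+1%:R)).
    by rewrite ler_nat -addnn ltnS leq_addr.
  by rewrite -[leLHS]expr1 ler_weXn2l // ler1n.
exact: cvg_cst.
Unshelve. all: by end_near. Qed.

(** The two halves of the summand differ by a shift of [k], so the partial sums
    are [1 + (-1) ^ m] times those of the odd reciprocals, up to the end terms.
    For odd [m] the factor vanishes, which also covers the divergent [m = 1]. *)
Lemma cvg_alternating_reciprocals (R : realType) (m : nat) : (1 <= m)%N ->
  \sum_(0 <= k < K) (k.*2.+1%:R ^- m + (-1) ^+ m * k.+1.*2.+1%:R ^- m)
    @[K --> \oo]
  --> (if odd m then 1 else 2 * rzeta R m * (1 - 2 ^- m) - 1 : R).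
Proof.
move=> m1.
have E : (fun K =>
    \sum_(0 <= k < K) (k.*2.+1%:R ^- m + (-1) ^+ m * k.+1.*2.+1%:R ^- m))
  = (fun K => (1 + (-1) ^+ m) * \sum_(0 <= k < K) (k.*2.+1%:R : R) ^- m
       + (-1) ^+ m * (K.*2.+1%:R ^- m - 1)).
  apply/funext; elim=> [|K IH].
    by rewrite !big_nil double0 mulr1n expr1n invr1 subrr !mulr0 addr0.
  by rewrite !big_nat_recr //= IH; ring.
rewrite E -signr_odd.
have tail : (-1) ^+ odd m * (K.*2.+1%:R ^- m - 1) @[K --> \oo] -->
    ((-1) ^+ odd m * (0 - 1) : R).
  apply: cvgMl_tmp; apply: cvgB; last exact: cvg_cst.
  exact: cvg_odd_reciprocal.
case: (boolP (odd m)) tail => [mo|me]; rewrite /= ?expr1 ?expr0.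
  rewrite subrr sub0r mulrNN mulr1.
  by move=> tail; under [X in X @ _]funext do rewrite mul0r add0r.
rewrite !mul1r sub0r -mulrA => tail; apply: cvgD => //; apply: cvgMl_tmp.
apply: cvg_odd_reciprocals.
by case: m m1 me {E tail} => [|[|]].
Qed.

(** * The series of zeta values *)

Lemma zeta_term_real (R : realType) (n m : nat) :
  zeta (2 * n.+1)%N%:R / (n.+1%:R * 4 ^+ n.+1) * 'C((2 * n.+1)%N, m)%:R =
  (rzeta R (2 * n.+1) / (n.+1%:R * 4 ^+ n.+1) * 'C(2 * n.+1, m)%:R)%:C.
Proof.
rewrite zeta_natE; last by rewrite mul2n doubleS.
by rewrite !(rmorphM, fmorphV, rmorphXn, rmorph_nat).
Qed.

Theorem theorem2p3 (R : realType) (m : nat) (hm : (1 <= m)%N) :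
  (\sum_(1 <= n < N.+1)
     zeta (2 * n)%N%:R / (n%:R * 4 ^+ n) * 'C((2 * n)%N, m)%:R : R[i]^o) @[N --> \oo] -->
  (if odd m then 1 / m%:R
   else 1 / m%:R * (2 * zeta m%:R * (1 - 1 / 2 ^+ m) - 1) : R[i]^o).
Proof.
pose L : R := m%:R^-1 * (if odd m then 1 else 2 * rzeta R m * (1 - 2 ^- m) - 1).
have -> : (if odd m then 1 / m%:R
    else 1 / m%:R * (2 * zeta m%:R * (1 - 1 / 2 ^+ m) - 1)) = L%:C.
  rewrite /L !div1r; case: (boolP (odd m)) => [mo|me].
    by rewrite mulr1 fmorphV rmorph_nat.
  rewrite zeta_natE; last by case: m hm me {L} => [|[|]].
  by rewrite !(rmorphM, rmorphB, fmorphV, rmorphXn, rmorph_nat, rmorph1).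
have -> : (fun N => \sum_(1 <= n < N.+1)
      zeta (2 * n)%N%:R / (n%:R * 4 ^+ n) * 'C(2 * n, m)%:R : R[i]^o) =
    (fun N => (\sum_(0 <= n < N)
      rzeta R (2 * n.+1) / (n.+1%:R * 4 ^+ n.+1) * 'C(2 * n.+1, m)%:R)%:C).
  apply/funext => N; rewrite big_add1 /= rmorph_sum.
  by apply: eq_bigr => n _; rewrite zeta_term_real.
apply: cvg_real_complex.
case: m hm @L => // m _ L.
apply: (@cvg_series_exchange R
  (fun i j => 'C(i.+1.*2, m.+1)%:R / i.+1%:R * (j.+1.*2%:R : R)^-1 ^+ i.+1.*2)
  _ (fun j => m.+1%:R^-1 *
       (j.*2.+1%:R ^- m.+1 + (-1) ^+ m.+1 * j.+1.*2.+1%:R ^- m.+1))).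
- by move=> i j; rewrite mulr_ge0 ?divr_ge0 ?exprn_ge0 ?invr_ge0.
- move=> i.
  have -> : (fun N => \sum_(0 <= j < N)
      'C(i.+1.*2, m.+1)%:R / i.+1%:R * (j.+1.*2%:R : R)^-1 ^+ i.+1.*2) =
    (fun N => ('C(i.+1.*2, m.+1)%:R / i.+1%:R / 4 ^+ i.+1) *
      \sum_(0 <= j < N) j.+1%:R ^- i.+1.*2).
    apply/funext => N; rewrite mulr_sumr; apply: eq_bigr => j _.
    rewrite -[RHS]mulrA; congr (_ * _).
    (* splits off the 4 ^- n of the theorem from (2 k) ^- (2 n) *)
    rewrite -[j.+1.*2]mul2n natrM invfM exprMn -!exprVn; congr (_ * _).
    by rewrite -mul2n exprM [_^-1 ^+ 2]exprVn -natrX.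
  have -> : rzeta R (2 * i.+1) / (i.+1%:R * 4 ^+ i.+1) *
        'C(2 * i.+1, m.+1)%:R =
      'C(i.+1.*2, m.+1)%:R / i.+1%:R / 4 ^+ i.+1 * rzeta R i.+1.*2.
    by rewrite mul2n invfM !mulrA; ring.
  by apply: cvgMl_tmp; apply: cvg_rzeta; rewrite doubleS.
- by move=> j; exact: cvg_even_binomial_series.
under [X in X @ _]funext do rewrite -mulr_sumr.
by apply: cvgMl_tmp; apply: cvg_alternating_reciprocals.
Qed.
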